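(* Let $(Y,\mathscr O_Y(1))$ be a connected projective $\mathbb C$-scheme such that $H^i(Y,\mathscr O_Y(1))=0$ for all $i>0$. Let $A$ be the homogeneous coordinate ring of $(Y,\mathscr O_Y(1))$, i.e. the image of $\mathrm{Sym}\,\Gamma(Y,\mathscr O_Y(1))\to\bigoplus_{n\ge0}\Gamma(Y,\mathscr O_Y(n))$, which is a connected graded algebra generated in degree $1$. Then the polarized scheme $(Y,\mathscr O_Y(1))$ is Hilbert stable if and only if the graded algebra $A$ is stable.
   Context: $\mathbb C$ is the ground field, a field of characteristic zero. Hilbert stability means Hilbert stability with respect to $r=1$ in the sense of Ross-Thomas. It is tested against filtrations of $A_1=\Gamma(Y,\mathscr O_Y(1))$, as follows. Let $A_1\supsetneq V^{(1)}\supset\cdots\supset V^{(r)}\supsetneq0$ be a filtration by vector subspaces (inclusions $\supset$ may be equalities), and set $V^{(0)}=A_1$ and $V^{(k)}=0$ for $k>r$. The admissible sequence of ideals it generates is $I^{(k)}\subset A$, $k\geq1$, with degree $n$ part $I^{(k)}_n=\sum_{k_1+\cdots+k_n\ge k}V^{(k_1)}\cdots V^{(k_n)}$ (all $k_j\ge0$); its weights are $w_n=\sum_{k\ge1}\dim I_n^{(k)}$ and its Futaki function is $F(n)=w_n/(n\dim A_n)$. $(Y,\mathscr O_Y(1))$ is Hilbert stable if there is $N$ such that for all $q\ge N$ and all such filtrations of $A_1$ one has $F(q)>F(1)$. (This is the Hilbert-Mumford form of GIT stability, under $SL(A_1)$, of the $q$-th Hilbert points, given by the quotients $\mathrm{Sym}^qA_1\to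 A_q$, for all large $q$.) Stability of graded algebras: let $A$ be a connected graded algebra ($A_0=\mathbb C$), finitely generated in degree $1$. A test configuration for a connected locally finite graded algebra $A'$ is a doubly graded $\mathbb C[t]$-subalgebra $B=\bigoplus_{k\in\mathbb Z}B^{(k)}t^{-k}\subset A'[t,t^{-1}]$ such that every $B_i\subset A'_i[t,t^{-1}]$ is a finitely generated $\mathbb C[t]$-submodule of rank $\dim A'_i$. It is trivial if there is $\ell\in\mathbb Z$ with $B^{(k)}_i=A'_i$ for $k\le i\ell$ and $B_i^{(k)}=0$ for $k>i\ell$. Its weights are $w_i=\sum_kk\dim(B^{(k)}_i/B_i^{(k+1)})$ and its Futaki function is $F(i)=w_i/(i\dim A'_i)$, $i>0$, with values in $\mathbb Q\cup\{\infty\}$. For $q>1$, $A$ is $q$-stable if $F(q)>F(1)$ for every non-trivial test configuration for the truncation $A_{\le q}=A/A_{>q}$. $A$ is stable if there exists $N>0$ such that $A$ is $q$-stable for all $q\ge N$. *)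

(* Defs.v *)
From HB Require Import structures.
From mathcomp Require Import all_boot all_order all_algebra.
From mathcomp Require Import generic_quotient.
From mathcomp Require Import boolp classical_sets functions fsbigop.
From mathcomp Require Import constructive_ereal topology.
From mathcomp Require Import ring.

Set Implicit Arguments.
Unset Strict Implicit.
Unset Printing Implicit Defensive.

Import Order.TTheory GRing.Theory Num.Theory.

Local Open Scope classical_set_scope.
Local Open Scope ring_scope.
Local Open Scope quotient_scope.

Record mulset (S : comNzRingType) := MulSet {
  mset :> S -> Prop;
  mset1 : mset 1;
  msetM : forall f g, mset f -> mset g -> mset (f * g) }.

Section Localization.
Variables (S : comNzRingType) (M : mulset S).

Record ratio := Ratio { num : S; den : S; denP : M den }.

HB.instance Definition _ := gen_eqMixin ratio.
HB.instance Definition _ := gen_choiceMixin ratio.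

Definition ratio_eq (x y : ratio) : bool :=
  `[< exists2 h, M h & h * (num x * den y) = h * (num y * den x) >].

Lemma ratio_eq_refl : reflexive ratio_eq.
Proof. by move=> x; apply/asboolP; exists 1 => //; exact: mset1. Qed.

Lemma ratio_eq_sym : symmetric ratio_eq.
Proof.
by move=> x y; apply/asboolP/asboolP => -[h Mh e]; exists h.
Qed.

Lemma ratio_eq_trans : transitive ratio_eq.
Proof.
move=> y x z /asboolP[h Mh e] /asboolP[g Mg e']; apply/asboolP.
exists (h * g * den y); first by do !apply: msetM => //; exact: denP.
transitivity (g * den z * (h * (num x * den y))).
  by ring.
rewrite e; transitivity (h * den x * (g * (num y * den z))).
  by ring.
by rewrite e'; ring.
Qed.

Canonical ratio_equiv :=
  EquivRel ratio_eq ratio_eq_refl ratio_eq_sym ratio_eq_trans.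

Definition loc := {eq_quot ratio_eq}.

HB.instance Definition _ : EqQuotient _ ratio_eq loc := EqQuotient.on loc.
HB.instance Definition _ := Choice.on loc.

Definition frac (a f : S) (Mf : M f) : loc := \pi_loc (Ratio a Mf).

Lemma fracP a f b g (Mf : M f) (Mg : M g) :
  frac a Mf = frac b Mg <-> exists2 h, M h & h * (a * g) = h * (b * f).
Proof. by split=> [/eqmodP/asboolP //|e]; apply/eqmodP/asboolP. Qed.

Lemma locW (P : loc -> Prop) :
  (forall a f (Mf : M f), P (frac a Mf)) -> forall x, P x.
Proof. by move=> H; elim/quotW => -[a f Mf]; exact: H. Qed.

Definition ratio_add (x y : ratio) : ratio :=
  Ratio (num x * den y + num y * den x) (msetM (denP x) (denP y)).
Definition ratio_opp (x : ratio) : ratio := Ratio (- num x) (denP x).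
Definition ratio_mul (x y : ratio) : ratio :=
  Ratio (num x * num y) (msetM (denP x) (denP y)).

Definition loc_add := lift_op2 loc ratio_add.
Definition loc_opp := lift_op1 loc ratio_opp.
Definition loc_mul := lift_op2 loc ratio_mul.
Definition loc_of (a : S) : loc := frac a (mset1 M).

Lemma repr_frac a f (Mf : M f) :
  let x := repr (frac a Mf) in
  exists2 h, M h & h * (num x * f) = h * (a * den x).
Proof.
move=> x; have: \pi_loc x = \pi_loc (Ratio a Mf) by rewrite reprK.
by move/eqmodP/asboolP.
Qed.

Lemma loc_addE a f b g (Mf : M f) (Mg : M g) :
  loc_add (frac a Mf) (frac b Mg) = frac (a * g + b * f) (msetM Mf Mg).
Proof.
rewrite /loc_add; unlock; apply/fracP => /=.
have [h Mh e] := repr_frac a Mf; have [h' Mh' e'] := repr_frac b Mg.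
set x := repr _ in e *; set y := repr _ in e' *.
exists (h * h'); first exact: msetM.
rewrite !mulrDl !mulrDr; congr (_ + _).
  transitivity (h' * den y * g * (h * (num x * f))).
    by ring.
  by rewrite e; ring.
transitivity (h * den x * f * (h' * (num y * g))).
  by ring.
by rewrite e'; ring.
Qed.

Lemma loc_oppE a f (Mf : M f) : loc_opp (frac a Mf) = frac (- a) Mf.
Proof.
rewrite /loc_opp; unlock; apply/fracP => /=.
have [h Mh e] := repr_frac a Mf; exists h => //.
by rewrite !mulNr !mulrN e.
Qed.

Lemma loc_mulE a f b g (Mf : M f) (Mg : M g) :
  loc_mul (frac a Mf) (frac b Mg) = frac (a * b) (msetM Mf Mg).
Proof.
rewrite /loc_mul; unlock; apply/fracP => /=.
have [h Mh e] := repr_frac a Mf; have [h' Mh' e'] := repr_frac b Mg.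
set x := repr _ in e *; set y := repr _ in e' *.
exists (h * h'); first exact: msetM.
transitivity ((h * (num x * f)) * (h' * (num y * g))).
  by ring.
by rewrite e e'; ring.
Qed.

Lemma frac_eq a f b g (Mf : M f) (Mg : M g) :
  a * g = b * f -> frac a Mf = frac b Mg.
Proof. by move=> e; apply/fracP; exists 1; [exact: mset1 | rewrite e]. Qed.

Lemma loc_addA : associative loc_add.
Proof.
elim/locW => a f Mf; elim/locW => b g Mg; elim/locW => c h Mh.
rewrite !loc_addE; apply: frac_eq; ring.
Qed.

Lemma loc_addC : commutative loc_add.
Proof.
elim/locW => a f Mf; elim/locW => b g Mg.
by rewrite !loc_addE; apply: frac_eq; rewrite addrC [g * f]mulrC.
Qed.

Lemma loc_add0 : left_id (loc_of 0) loc_add.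
Proof.
elim/locW => a f Mf; rewrite loc_addE; apply: frac_eq.
by rewrite mul0r add0r mulr1 mul1r.
Qed.

Lemma loc_addN : left_inverse (loc_of 0) loc_opp loc_add.
Proof.
elim/locW => a f Mf; rewrite loc_oppE loc_addE; apply: frac_eq.
by rewrite mulNr addNr !mul0r.
Qed.

HB.instance Definition _ :=
  GRing.isZmodule.Build loc loc_addA loc_addC loc_add0 loc_addN.

Lemma loc_mulA : associative loc_mul.
Proof.
elim/locW => a f Mf; elim/locW => b g Mg; elim/locW => c h Mh.
by rewrite !loc_mulE; apply: frac_eq; rewrite !mulrA.
Qed.

Lemma loc_mulC : commutative loc_mul.
Proof.
elim/locW => a f Mf; elim/locW => b g Mg.
by rewrite !loc_mulE; apply: frac_eq; rewrite [b * a]mulrC [g * f]mulrC.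
Qed.

Lemma loc_mul1 : left_id (loc_of 1) loc_mul.
Proof.
elim/locW => a f Mf; rewrite loc_mulE; apply: frac_eq.
by rewrite !mul1r.
Qed.

Lemma loc_mulDl : left_distributive loc_mul loc_add.
Proof.
elim/locW => a f Mf; elim/locW => b g Mg; elim/locW => c h Mh.
rewrite !(loc_mulE, loc_addE); apply: frac_eq; ring.
Qed.

HB.instance Definition _ := GRing.Zmodule_isComPzRing.Build loc
  loc_mulA loc_mulC loc_mul1 loc_mulDl.

End Localization.

Record opens (X : topologicalType) := Opens {
  oset :> X -> Prop;
  oset_open : open (oset : set X) }.

Definition whole (X : topologicalType) : opens X := Opens (@openT X).

Section Sheaves.
Variable X : topologicalType.

Definition sub_open (V U : opens X) := forall x, V x -> U x.

Record presheaf := Presheaf {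
  sec :> opens X -> zmodType;
  res : forall U V, sub_open V U -> {additive sec U -> sec V};
  res_id : forall U (h : sub_open U U) s, res h s = s;
  res_comp : forall U V W (h : sub_open V U) (h' : sub_open W V)
    (h'' : sub_open W U) s, res h' (res h s) = res h'' s }.

Arguments res {p U V} h.

Record sheaf_axiom (F : presheaf) : Prop := SheafAxiom {
  sheaf_sep : forall (U : opens X) (I : Type) (V : I -> opens X)
    (VU : forall i, sub_open (V i) U),
    (forall x, U x -> exists i, V i x) ->
    forall s : F U, (forall i, res (VU i) s = 0) -> s = 0;
  sheaf_glue : forall (U : opens X) (I : Type) (V : I -> opens X)
    (VU : forall i, sub_open (V i) U),
    (forall x, U x -> exists i, V i x) ->
    forall s : (forall i, F (V i)),
    (forall i j W (hi : sub_open W (V i)) (hj : sub_open W (V j)),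
       res hi (s i) = res hj (s j)) ->
    exists t : F U, forall i, res (VU i) t = s i }.

Record sheaf := Sheaf { psh :> presheaf; sheafP : sheaf_axiom psh }.

Record shmor (F G : sheaf) := ShMor {
  shapp :> forall U, {additive F U -> G U};
  shapp_res : forall U V (h : sub_open V U) s,
    shapp V (res h s) = res h (shapp U s) }.

Definition sh_mono (F G : sheaf) (f : shmor F G) :=
  forall U, injective (f U).

(* kernel = sheaf image *)
Definition sh_exact (F G H : sheaf) (f : shmor F G) (g : shmor G H) :=
  forall U (t : G U), g U t = 0 <->
    forall x, U x -> exists (V : opens X) (h : sub_open V U),
      V x /\ exists s : F V, f V s = res h t.

Definition sh_injective (J : sheaf) :=
  forall (F G : sheaf) (m : shmor F G) (f : shmor F J), sh_mono m ->
    exists g : shmor G J, forall U (s : F U), g U (m U s) = f U s.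

Record injective_resolution (F : sheaf) := InjRes {
  ires :> nat -> sheaf;
  ires_inj : forall i, sh_injective (ires i);
  ires_aug : shmor F (ires 0%N);
  ires_d : forall i, shmor (ires i) (ires i.+1);
  ires_mono : sh_mono ires_aug;
  ires_exact0 : sh_exact ires_aug (ires_d 0%N);
  ires_exact : forall i, sh_exact (ires_d i) (ires_d i.+1) }.

(* H^i(X, F) = 0, with H^* the right derived functors of global sections *)
Definition cohomology_vanishes (F : sheaf) (i : nat) :=
  forall J : injective_resolution F,
  match i with
  | 0 => forall s : J 0%N (whole X), ires_d J 0 (whole X) s = 0 -> s = 0
  | i'.+1 => forall s : J i'.+1 (whole X), ires_d J i'.+1 (whole X) s = 0 ->
      exists t : J i' (whole X), ires_d J i' (whole X) t = s
  end.

End Sheaves.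

(* S = K[x_1, ..., x_r]/I with I homogeneous and deg x_i = 1; the polarized
   projective schemes (Y, O_Y(1)) are the (Proj S, O(1)) for such S *)
Record standard_grading (K : fieldType) (S : comAlgType K) := StdGrading {
  gr :> nat -> S -> Prop;
  gr_zero : forall n, gr n 0;
  gr_lin : forall n c a b, gr n a -> gr n b -> gr n (c *: a + b);
  gr_one : gr 0%N 1;
  gr_mul : forall m n a b, gr m a -> gr n b -> gr (m + n)%N (a * b);
  gr_dec : forall a, exists (N : nat) (f : nat -> S),
    (forall i, gr i (f i)) /\ a = \sum_(i < N) f i;
  gr_uniq : forall N (f : nat -> S), (forall i, gr i (f i)) ->
    \sum_(i < N) f i = 0 -> forall i, (i < N)%N -> f i = 0;
  gr_const : forall a, gr 0%N a -> exists c : K, a = c%:A;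
  gr_gen : exists (r : nat) (x : 'I_r -> S), (forall i, gr 1%N (x i)) /\
    forall T : S -> Prop,
      (forall i, T (x i)) -> (forall c : K, T c%:A) ->
      (forall a b, T a -> T b -> T (a + b)) ->
      (forall a b, T a -> T b -> T (a * b)) -> forall a, T a }.

Section Proj.
Variables (K : fieldType) (S : comAlgType K) (G : standard_grading S).

Record is_point (P : S -> Prop) : Prop := IsPoint {
  pt_zero : P 0;
  pt_add : forall a b, P a -> P b -> P (a + b);
  pt_mul : forall a b, P b -> P (a * b);
  pt_proper : ~ P 1;
  pt_prime : forall a b, P (a * b) -> P a \/ P b;
  pt_homog : forall N (f : nat -> S), (forall i, G i (f i)) ->
    P (\sum_(i < N) f i) -> forall i, (i < N)%N -> P (f i);
  pt_relevant : exists n a, (0 < n)%N /\ G n a /\ ~ P a }.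

Record Proj := ProjPt { pt :> S -> Prop; ptP : is_point pt }.

HB.instance Definition _ := gen_eqMixin Proj.
HB.instance Definition _ := gen_choiceMixin Proj.

Definition homogeneous (a : S) := exists d, G d a.

(* U is the complement of V_+(E) for a set E of homogeneous elements *)
Definition proj_open (U : set Proj) :=
  exists E : set S, E `<=` homogeneous /\
    U = [set p : Proj | exists2 a, E a & ~ p a].

Lemma proj_openT : proj_open setT.
Proof.
exists homogeneous; split=> //; apply/seteqP; split=> // p _.
by have [n [a [_ [Ga pa]]]] := pt_relevant (ptP p); exists a => //; exists n.
Qed.

Lemma proj_openI : setI_closed proj_open.
Proof.
move=> U V [E [hE ->]] [E' [hE' ->]].
exists [set c | exists a b, [/\ E a, E' b & c = a * b]]; split.
  move=> _ [a [b [/hE [m Ga] /hE' [n Gb] ->]]].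
  by exists (m + n)%N; exact: gr_mul.
apply/seteqP; split=> p.
  move=> [[a Ea pa] [b Eb pb]]; exists (a * b); first by exists a, b.
  by case/(pt_prime (ptP p)).
move=> [_ [a [b [Ea Eb ->]]] pab]; split; [exists a | exists b] => // pc; apply: pab.
  by rewrite mulrC; exact: pt_mul (ptP p) _ _ _.
exact: pt_mul (ptP p) _ _ _.
Qed.

Lemma proj_open_bigU (I : Type) (f : I -> set Proj) :
  (forall i, proj_open (f i)) -> proj_open (\bigcup_i f i).
Proof.
move=> /choice[E hE]; exists (\bigcup_i E i); split.
  by move=> a [i _ Ea]; exact: (hE i).1.
apply/seteqP; split=> p.
  by move=> [i _]; rewrite (hE i).2 => -[a Ea pa]; exists a => //; exists i.
by move=> [a [i _ Ea] pa]; exists i => //; rewrite (hE i).2; exists a.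
Qed.

HB.instance Definition _ :=
  isOpenTopological.Build Proj proj_openT proj_openI proj_open_bigU.

Definition homog_compl (p : Proj) (f : S) := homogeneous f /\ ~ p f.

Lemma homog_compl1 p : homog_compl p 1.
Proof. by split; [exists 0%N; exact: gr_one | exact: pt_proper (ptP p)]. Qed.

Lemma homog_complM p f g :
  homog_compl p f -> homog_compl p g -> homog_compl p (f * g).
Proof.
move=> [[m Gf] pf] [[n Gg] pg]; split; first by exists (m + n)%N; exact: gr_mul.
by case/(pt_prime (ptP p)).
Qed.

Definition stalk_mulset (p : Proj) : mulset S :=
  MulSet (homog_compl1 p) (@homog_complM p).

(* the stalk of O(n) at p is the degree n part of this ring *)
Definition hloc (p : Proj) := loc (stalk_mulset p).

Section Sections.
Variables (n : nat) (U : opens Proj).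

(* locally of the form a / f with deg a = deg f + n *)
Definition regular (s : forall p, U p -> hloc p) :=
  forall p, U p -> exists V : opens Proj,
    V p /\ exists d a f, [/\ G (d + n)%N a, G d f &
      forall q (Uq : U q), V q ->
        exists hf : stalk_mulset q f, s q Uq = frac a hf].

Record Osec := MkOsec {
  osec :> forall p, U p -> hloc p;
  osecP : regular osec }.

HB.instance Definition _ := gen_eqMixin Osec.
HB.instance Definition _ := gen_choiceMixin Osec.

Lemma osec_inj (s t : Osec) : (forall p Up, s p Up = t p Up) -> s = t.
Proof.
case: s t => [s hs] [t ht] /= e.
have est : s = t.
  by apply: functional_extensionality_dep => p;
     apply: functional_extensionality_dep => Up.
by case: _ / est ht => ht; congr MkOsec; exact: Prop_irrelevance.
Qed.

Lemma regular0 : regular (fun p _ => 0).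
Proof.
move=> p Up; exists (whole _); split=> //; exists 0%N, 0, 1.
split=> [||q Uq _]; [exact: gr_zero | exact: gr_one |].
by exists (mset1 (stalk_mulset q)).
Qed.

Lemma regularN s : regular s -> regular (fun p Up => - s p Up).
Proof.
move=> hs p /hs [V [Vp [d [a [f [Ga Gf e]]]]]].
exists V; split=> //; exists d, (- a), f; split=> // [|q Uq Vq].
  by rewrite -[- a]addr0 -scaleN1r; apply: gr_lin => //; exact: gr_zero.
by have [hf ->] := e q Uq Vq; exists hf; exact: loc_oppE.
Qed.

Lemma regularD s t :
  regular s -> regular t -> regular (fun p Up => s p Up + t p Up).
Proof.
move=> hs ht p Up.
have [V [Vp [d [a [f [Ga Gf e]]]]]] := hs p Up.
have [W [Wp [c [b [g [Gb Gg e']]]]]] := ht p Up.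
exists (Opens (openI (oset_open V) (oset_open W))); split=> //.
exists (d + c)%N, (a * g + b * f), (f * g); split=> [||q Uq [Vq Wq]].
- rewrite -[a * g]scale1r; apply: gr_lin.
    by rewrite addnAC; exact: gr_mul.
  by rewrite [(d + c)%N]addnC addnAC; exact: gr_mul.
- exact: gr_mul.
have [hf ->] := e q Uq Vq; have [hg ->] := e' q Uq Wq.
by exists (msetM hf hg); exact: loc_addE.
Qed.

Definition Osec0 := MkOsec regular0.
Definition Osec_opp (s : Osec) := MkOsec (regularN (osecP s)).
Definition Osec_add (s t : Osec) := MkOsec (regularD (osecP s) (osecP t)).

Lemma Osec_addA : associative Osec_add.
Proof. by move=> s t u; apply: osec_inj => p Up /=; exact: addrA. Qed.
Lemma Osec_addC : commutative Osec_add.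
Proof. by move=> s t; apply: osec_inj => p Up /=; exact: addrC. Qed.
Lemma Osec_add0 : left_id Osec0 Osec_add.
Proof. by move=> s; apply: osec_inj => p Up /=; exact: add0r. Qed.
Lemma Osec_addN : left_inverse Osec0 Osec_opp Osec_add.
Proof. by move=> s; apply: osec_inj => p Up /=; exact: addNr. Qed.

HB.instance Definition _ :=
  GRing.isZmodule.Build Osec Osec_addA Osec_addC Osec_add0 Osec_addN.

End Sections.

Section Restriction.
Variables (n : nat) (U V : opens Proj) (h : sub_open V U).

Lemma regular_res (s : Osec n U) :
  @regular n V (fun p Vp => s p (h Vp)).
Proof.
move=> p Vp; have [W [Wp [d [a [f [Ga Gf e]]]]]] := osecP s (h Vp).
by exists W; split=> //; exists d, a, f; split=> // q Vq Wq; exact: e.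
Qed.

Definition Ores (s : Osec n U) : Osec n V := MkOsec (regular_res s).

Lemma Ores_additive : zmod_morphism Ores.
Proof. by move=> s t; apply: osec_inj. Qed.

HB.instance Definition _ :=
  GRing.isZmodMorphism.Build (Osec n U) (Osec n V) Ores Ores_additive.

End Restriction.

Lemma Ores_id n U (h : sub_open U U) (s : Osec n U) : Ores h s = s.
Proof.
by apply: osec_inj => p Up /=; congr (osec s _); exact: Prop_irrelevance.
Qed.

Lemma Ores_comp n (U V W : opens Proj) (h : sub_open V U) (h' : sub_open W V)
  (h'' : sub_open W U) (s : Osec n U) : Ores h' (Ores h s) = Ores h'' s.
Proof.
by apply: osec_inj => p Up /=; congr (osec s _); exact: Prop_irrelevance.
Qed.

Definition Opsh (n : nat) : presheaf Proj :=
  @Presheaf Proj (fun U => Osec n U) (fun U V h => Ores h : {additive _ -> _})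
    (@Ores_id n) (@Ores_comp n).

Lemma Osheaf_axiom n : sheaf_axiom (Opsh n).
Proof.
split=> U I V VU cov s hs.
  apply: osec_inj => p Up; have [i Vp] := cov p Up.
  have /(congr1 (fun t : Osec n (V i) => t p Vp)) /= := hs i.
  by rewrite (Prop_irrelevance Up (VU i p Vp)).
have sE i j p (Vi : V i p) (Vj : V j p) : osec (s i) Vi = osec (s j) Vj.
  pose W := Opens (openI (oset_open (V i)) (oset_open (V j))).
  have hi : sub_open W (V i) by move=> ? [].
  have hj : sub_open W (V j) by move=> ? [].
  have Wp : W p by split.
  have /(congr1 (fun t : Osec n W => t p Wp)) /= := hs i j W hi hj.
  by rewrite (Prop_irrelevance (hi _ _) Vi) (Prop_irrelevance (hj _ _) Vj).
pose ix p (Up : U p) := cid (cov p Up).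
pose t p (Up : U p) : hloc p := osec (s (sval (ix p Up))) (svalP (ix p Up)).
have tE p (Up : U p) i (Vp : V i p) : t p Up = osec (s i) Vp by exact: sE.
have ht : @regular n U t.
  move=> p Up; have [i Vp] := cov p Up.
  have [W [Wp [d [a [f [Ga Gf e]]]]]] := osecP (s i) Vp.
  exists (Opens (openI (oset_open (V i)) (oset_open W))); split=> //.
  exists d, a, f; split=> // q Uq [Vq Wq].
  by have [hf e'] := e q Vq Wq; exists hf; rewrite (tE _ _ _ Vq).
by exists (MkOsec ht) => i; apply: osec_inj => p Vp /=; exact: tE.
Qed.

Definition OProj (n : nat) : sheaf Proj := Sheaf (Osheaf_axiom n).

Definition at_pt n (s : OProj n (whole Proj)) (p : Proj) : hloc p :=
  osec (s : Osec n (whole Proj)) (I : whole Proj p).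

End Proj.

(* A = (+)_i A_i; the product A_i x A_j -> A_l carries a proof of i + j = l, so
   that associativity and unitality need no transport *)
Record graded_algebra (K : fieldType) := GradedAlgebra {
  piece :> nat -> vectType K;
  gone : piece 0%N;
  gmul : forall i j l, (i + j)%N = l -> piece i -> piece j -> piece l;
  gmul_linl : forall i j l (e : (i + j)%N = l) y, linear (gmul e ^~ y);
  gmul_linr : forall i j l (e : (i + j)%N = l) x, linear (gmul e x);
  gmul1l : forall i (e : (0 + i)%N = i) x, gmul e gone x = x;
  gmul1r : forall i (e : (i + 0)%N = i) x, gmul e x gone = x;
  gmulA : forall i j m ij jm l (eij : (i + j)%N = ij) (el : (ij + m)%N = l)
    (ejm : (j + m)%N = jm) (el' : (i + jm)%N = l) x y z,
    gmul el (gmul eij x y) z = gmul el' x (gmul ejm y z);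
  gone_neq0 : gone != 0;
  gconnected : forall x : piece 0%N, exists c : K, x = c *: gone }.

Arguments gone {K} g.
Arguments gmul {K g i j l} e x y.

Section Truncation.
Variables (K : fieldType) (A : graded_algebra K) (q : nat).

Definition tpiece (i : nat) : vectType K :=
  if (i <= q)%N then A i else 'rV[K]_0.

Definition tlift (i : nat) : tpiece i -> A i :=
  (if (i <= q)%N as b return
     ((if b then A i else 'rV[K]_0 : vectType K) -> A i)
   then id else fun _ => 0).

Definition tproj (i : nat) : A i -> tpiece i :=
  (if (i <= q)%N as b return
     (A i -> (if b then A i else 'rV[K]_0 : vectType K))
   then id else fun _ => 0).

Lemma tlift_linear i : linear (@tlift i).
Proof.
rewrite /tlift /tpiece; case: (i <= q)%N => c x y //.
by rewrite scaler0 addr0.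
Qed.

Lemma tproj_linear i : linear (@tproj i).
Proof.
rewrite /tproj /tpiece; case: (i <= q)%N => c x y //.
by rewrite scaler0 addr0.
Qed.

Lemma tliftK i : cancel (@tlift i) (@tproj i).
Proof.
rewrite /tlift /tproj /tpiece; case: (i <= q)%N => // x.
by apply/rowP => -[].
Qed.

Lemma tprojK i : (i <= q)%N -> cancel (@tproj i) (@tlift i).
Proof. by rewrite /tlift /tproj /tpiece; case: (i <= q)%N. Qed.

Lemma tproj_gt i x : (q < i)%N -> @tproj i x = 0.
Proof. by rewrite /tproj /tpiece ltnNge; case: (i <= q)%N. Qed.

Definition tone : tpiece 0 := tproj (gone A).

Definition tmul i j l (e : (i + j)%N = l) (x : tpiece i) (y : tpiece j) :
  tpiece l := tproj (gmul e (tlift x) (tlift y)).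

Lemma tmul_linl i j l (e : (i + j)%N = l) y : linear (tmul e ^~ y).
Proof.
by move=> c x x'; rewrite /tmul tlift_linear gmul_linl tproj_linear.
Qed.

Lemma tmul_linr i j l (e : (i + j)%N = l) x : linear (tmul e x).
Proof.
by move=> c y y'; rewrite /tmul tlift_linear gmul_linr tproj_linear.
Qed.

Lemma tmul1l i (e : (0 + i)%N = i) x : tmul e tone x = x.
Proof. by rewrite /tmul tprojK // gmul1l tliftK. Qed.

Lemma tmul1r i (e : (i + 0)%N = i) x : tmul e x tone = x.
Proof. by rewrite /tmul tprojK // gmul1r tliftK. Qed.

Lemma tmulA i j m ij jm l (eij : (i + j)%N = ij) (el : (ij + m)%N = l)
    (ejm : (j + m)%N = jm) (el' : (i + jm)%N = l) x y z :
  tmul el (tmul eij x y) z = tmul el' x (tmul ejm y z).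
Proof.
rewrite /tmul; have [lq|ql] := leqP l q; last by rewrite !tproj_gt.
rewrite !tprojK ?(gmulA eij el ejm el') //.
  by rewrite (leq_trans _ lq) // -el' leq_addl.
by rewrite (leq_trans _ lq) // -el leq_addr.
Qed.

Lemma tone_neq0 : tone != 0.
Proof. exact: gone_neq0. Qed.

Lemma tconnected (x : tpiece 0) : exists c : K, x = c *: tone.
Proof. exact: gconnected. Qed.

(* A_{<= q} = A / A_{> q} *)
Definition truncation : graded_algebra K :=
  GradedAlgebra tmul_linl tmul_linr tmul1l tmul1r tmulA tone_neq0 tconnected.

End Truncation.

(* f : int -> V of finite support stands for sum_k f(k) t^(-k) *)
Section Laurent.
Variables (K : fieldType) (V : vectType K).

Definition laurent_sub (B : int -> {vspace V}) (f : int -> V) :=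
  (exists N : nat, forall k : int, (N < `|k|)%N -> f k = 0) /\
  forall k, f k \in B k.

Definition poly_act (p : {poly K}) (f : int -> V) : int -> V :=
  fun k => \sum_(j < size p) p`_j *: f (k + j%:Z).

Definition lincomb n (p : 'I_n -> {poly K}) (g : 'I_n -> int -> V) : int -> V :=
  fun k => \sum_(i < n) poly_act (p i) (g i) k.

Definition fin_generated (M : (int -> V) -> Prop) :=
  exists (n : nat) (g : 'I_n -> int -> V), (forall i, M (g i)) /\
    forall f, M f -> exists p, f = lincomb p g.

Definition lin_indep n (g : 'I_n -> int -> V) :=
  forall p, lincomb p g = (fun=> 0) -> forall i, p i = 0.

Definition has_rank (M : (int -> V) -> Prop) (d : nat) :=
  (exists g : 'I_d -> int -> V, (forall i, M (g i)) /\ lin_indep g) /\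
  forall m (g : 'I_m -> int -> V), (forall i, M (g i)) -> lin_indep g ->
    (m <= d)%N.

End Laurent.

Section Stability.
Variable K : fieldType.

(* B i k is B_i^(k); tc_t is stability under multiplication by t *)
Record test_configuration (A : graded_algebra K) := TestConfiguration {
  tc :> forall i : nat, int -> {vspace A i};
  tc_t : forall i k, (tc i (k + 1) <= tc i k)%VS;
  tc_one : gone A \in tc 0%N 0;
  tc_mul : forall i j l (e : (i + j)%N = l) k m x y,
    x \in tc i k -> y \in tc j m -> gmul e x y \in tc l (k + m);
  tc_fg : forall i, fin_generated (laurent_sub (tc i));
  tc_rank : forall i, has_rank (laurent_sub (tc i)) (\dim {: A i}) }.

Definition tc_trivial (A : graded_algebra K) (B : test_configuration A) :=
  exists l : int, forall (i : nat) (k : int),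
    (k <= i%:Z * l -> B i k = fullv) /\ (i%:Z * l < k -> B i k = 0%VS).

Definition tc_weight (A : graded_algebra K) (B : test_configuration A)
    (i : nat) : int :=
  \sum_(k \in [set: int]) k * ((\dim (B i k))%:Z - (\dim (B i (k + 1)))%:Z).

(* w / (n d), with value +oo when d = 0 *)
Definition futaki (w : int) (n d : nat) : \bar rat :=
  if (n * d == 0)%N then +oo%E else (w%:~R / (n * d)%N%:R)%:E.

Definition tc_futaki (A : graded_algebra K) (B : test_configuration A)
  (i : nat) : \bar rat := futaki (tc_weight B i) i (\dim {: A i}).

Definition q_stable (A : graded_algebra K) (q : nat) :=
  forall B : test_configuration (truncation A q),
    ~ tc_trivial B -> (tc_futaki B 1 < tc_futaki B q)%E.

Definition stable (A : graded_algebra K) :=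
  exists N : nat, (0 < N)%N /\
    forall q, (N <= q)%N -> (1 < q)%N -> q_stable A q.

Record filtration (V : vectType K) (r : nat) := Filtration {
  filt :> nat -> {vspace V};
  filt_r : (0 < r)%N;
  filt0 : filt 0%N = fullv;
  filt1 : filt 1%N != fullv;
  filt_dec : forall k, (filt k.+1 <= filt k)%VS;
  filt_last : filt r != 0%VS;
  filt_gt : forall k, (r < k)%N -> filt k = 0%VS }.

Section Hilbert.
Variables (A : graded_algebra K).

Definition prod_space i j l (e : (i + j)%N = l) (U : {vspace A i})
    (W : {vspace A j}) : {vspace A l} :=
  <<[seq gmul e u w | u <- vbasis U, w <- vbasis W]>>%VS.

(* V^(ks 0) ... V^(ks (n-1)) *)
Fixpoint filt_prod (V : nat -> {vspace A 1%N}) (n : nat) :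
    ('I_n -> nat) -> {vspace A n} :=
  match n return ('I_n -> nat) -> {vspace A n} with
  | 0 => fun _ => <[gone A]>%VS
  | n'.+1 => fun ks => prod_space (add1n n') (V (ks ord0))
               (filt_prod V (fun i => ks (lift ord0 i)))
  end.

Variables (r : nat) (V : filtration (A 1%N) r).

(* I^(k)_n; since V^(j) = 0 for j > r, only indices k_j <= r contribute *)
Definition adm_ideal (k n : nat) : {vspace A n} :=
  (\sum_(ks : {ffun 'I_n -> 'I_r.+1} | (k <= \sum_i ks i)%N)
     filt_prod V (fun i => ks i))%VS.

Definition filt_weight (n : nat) : int :=
  \sum_(k \in [set k : nat | (1 <= k)%N]) (\dim (adm_ideal k n))%:Z.

Definition filt_futaki (n : nat) : \bar rat :=
  futaki (filt_weight n) n (\dim {: A n}).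

End Hilbert.

Definition hilbert_stable (A : graded_algebra K) :=
  exists N : nat, forall q, (N <= q)%N ->
    forall r (V : filtration (A 1%N) r),
      (filt_futaki V 1 < filt_futaki V q)%E.

(* degree n part of the image of Sym Gamma(Y, O(1)) in (+)_n Gamma(Y, O(n)) *)
Definition sym_image (S : comAlgType K) (G : standard_grading S) (n : nat)
    (s : OProj G n (whole (Proj G))) :=
  exists (m : nat) (c : 'I_m -> K)
    (u : 'I_m -> 'I_n -> OProj G 1 (whole (Proj G))),
    forall p, at_pt s p =
      \sum_(j < m) loc_of _ (c j)%:A * \prod_(i < n) at_pt (u j i) p.

(* phi identifies A with that image, as a graded algebra *)
Record is_coordinate_ring (S : comAlgType K) (G : standard_grading S)
    (A : graded_algebra K)
    (phi : forall n, A n -> OProj G n (whole (Proj G))) : Prop :=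
  IsCoordinateRing {
  cr_linear : forall n (c : K) (x y : A n) p,
    at_pt (phi n (c *: x + y)) p =
      loc_of _ c%:A * at_pt (phi n x) p + at_pt (phi n y) p;
  cr_one : forall p, at_pt (phi 0%N (gone A)) p = 1;
  cr_mul : forall i j l (e : (i + j)%N = l) x y p,
    at_pt (phi l (gmul e x y)) p = at_pt (phi i x) p * at_pt (phi j y) p;
  cr_inj : forall n, injective (phi n);
  cr_image : forall n s, sym_image s <-> exists x, phi n x = s }.

Definition homogeneous_coordinate_ring (S : comAlgType K)
    (G : standard_grading S) (A : graded_algebra K) :=
  exists phi : forall n, A n -> OProj G n (whole (Proj G)),
    is_coordinate_ring phi.

End Stability.

(* Main.v *)
(* A filtration [V] of [A_1] gives a test configuration of every truncation
   [A_{<= q}], with the same Futaki function in degrees [i <= q]: take [I^(k)_i]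
   for [k >= 1] and [A_i] for [k <= 0]. Hence stability implies Hilbert stability.

   Conversely let [B] be a test configuration of [A_{<= q}], and let [l] be the
   last index with [B_1^(l) = A_1]. As [A] is generated in degree 1,
   [B_n^(k) = A_n] for [k <= n l]. If [V^(k) = B_1^(l + k)] is a nonzero
   filtration, then multiplicativity gives [I^(k)_n <= B_n^(n l + k)], with
   equality for [n = 1], so that [F_B(1) = l + F_V(1) < l + F_V(q) <= F_B(q)].
   If [V^(1) = 0], then [F_B(1) = l] and [F_B(q) >= l], with equality iff
   [B_q^(q l + 1) = 0]. But a nonzero section of [O(n)] remains nonzero after
   multiplication by a suitable section of [O(1)], so a nonzero element of some
   [B_i^(k)] with [k > i l] has a nonzero multiple in [B_q^(q l + 1)]; such an
   element exists unless [B] is trivial. *)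

Require Import Defs.
From HB Require Import structures.
From mathcomp Require Import all_boot all_order all_algebra.
From mathcomp Require Import boolp classical_sets functions fsbigop.
From mathcomp Require Import constructive_ereal topology.
From mathcomp Require Import zify ring.

Set Implicit Arguments.
Unset Strict Implicit.
Unset Printing Implicit Defensive.

Import Order.TTheory GRing.Theory Num.Theory.

Local Open Scope classical_set_scope.
Local Open Scope ring_scope.

(** * Laurent submodules *)

Section LaurentModules.
Variables (K : fieldType) (V : vectType K).
Implicit Types (p : {poly K}) (f : int -> V) (B : int -> {vspace V}).

Lemma poly_act_widen p f k n : (size p <= n)%N ->
  poly_act p f k = \sum_(j < n) p`_j *: f (k + j%:Z).
Proof.
move=> pn; rewrite /poly_act (big_ord_widen n (fun j => p`_j *: f (k + j%:Z))) //.
rewrite big_mkcond /=; apply: eq_bigr => j _; case: ltnP => // pj.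
by rewrite nth_default // scale0r.
Qed.

(** The monomial [v t^(-k0)]. Multiplication by [t] lowers the index by one, so its multiples live
    at indices at most [k0]. *)
Definition single (k0 : int) (v : V) : int -> V :=
  fun k => if k == k0 then v else 0.

Lemma poly_act_single p k0 v k :
  poly_act p (single k0 v) k = if k <= k0 then p`_`|k0 - k|%N *: v else 0.
Proof.
rewrite (@poly_act_widen _ _ _ (size p + `|k0 - k|%N.+1)) ?leq_addr //.
case: ifP => kk0; last first.
  by rewrite big1 // => j _; rewrite /single ifF ?scaler0 //; apply/eqP; lia.
have lt : (`|k0 - k|%N < size p + `|k0 - k|%N.+1)%N by lia.
rewrite (bigD1 (Ordinal lt)) //= big1 ?addr0 => [|j /eqP ne].
  by rewrite /single ifT //; apply/eqP; lia.
rewrite /single ifF ?scaler0 //; apply/eqP => e; apply: ne; apply: val_inj => /=.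
by lia.
Qed.

Lemma poly_act_mem p f k (U : {vspace V}) :
  (forall k', f k' \in U) -> poly_act p f k \in U.
Proof. by move=> fU; apply: memv_suml => j _; exact: memvZ. Qed.

Lemma laurent_sub_bound B n (g : 'I_n -> int -> V) :
  (forall i, laurent_sub B (g i)) ->
  exists N : nat, forall i (k : int), (N < `|k|)%N -> g i k = 0.
Proof.
move=> Mg; have /choice[N hN] := fun i => (Mg i).1.
exists (\max_i N i)%N => i k lt; apply: hN.
by rewrite (leq_ltn_trans _ lt) // leq_bigmax.
Qed.

(* After a shift, the coordinates of the [g i] in a basis of [U] form a matrix
   over [K[t]] with fewer columns than rows; its rows are then dependent. *)
Lemma lin_indep_dim (U : {vspace V}) m (g : 'I_m -> int -> V) (N : nat) :
  (forall i (k : int), (N < `|k|)%N -> g i k = 0) ->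
  (forall i k, g i k \in U) -> lin_indep g -> (m <= \dim U)%N.
Proof.
move=> gN gU ind; rewrite leqNgt; apply/negP => Um.
(* Coordinate functionals are padded by zero past [\dim U], so [M] is square with a zero column and
   determinants apply. *)
pose cl (j : nat) : {linear V -> K^o} :=
  if insub j is Some j' then coord (vbasis U) (j' : 'I_(\dim U)) else \0.
(* Row [i] holds the coordinates of [t^N g_i], which are polynomials of degree at most [2N]. *)
pose M : 'M[{poly K}]_m :=
  \matrix_(i, j) \poly_(a < (N + N).+1) cl j (g i (N%:Z - a%:Z)).
have ME i j b : (M i j)`_b = cl j (g i (N%:Z - b%:Z)).
  rewrite mxE coef_poly; case: ltnP => // lt.
  by rewrite gN ?(linear0 (cl j)) //; lia.
have : \det M == 0.
  rewrite (expand_det_col _ (Ordinal Um)) big1 // => i _.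
  suff -> : M i (Ordinal Um) = 0 by rewrite mul0r.
  apply/polyP => b; rewrite ME coef0 /cl; case: insubP => //= j' lt.
  by rewrite ltnn in lt.
case/det0P => v v0 vM; move/negP: v0; apply; apply/eqP/rowP => i; rewrite mxE.
apply: (ind (v 0)); apply/funext => k.
have lU : lincomb (v 0) g k \in U.
  by apply: memv_suml => j _; exact: poly_act_mem.
rewrite (coord_vbasis lU) big1 // => j _.
have -> : coord (vbasis U) j (lincomb (v 0) g k) = cl j (lincomb (v 0) g k).
  by rewrite /cl valK.
suff -> : cl j (lincomb (v 0) g k) = 0 by rewrite scale0r.
rewrite linear_sum /=.
have [kN|Nk] := lerP k N%:Z; last first.
  apply: big1 => i' _; rewrite /poly_act big1 ?(linear0 (cl j)) // => a _.
  by rewrite gN ?scaler0 //; lia.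
(* Coordinate [j] of the combination at index [N - e] is the coefficient of [t^e] in column [j] of
   [v M = 0]. *)
pose e := `|N%:Z - k|%N; have eE : k = N%:Z - e%:Z by lia.
have jm : (j < m)%N by exact: ltn_trans (ltn_ord j) Um.
have vMj : \sum_i v 0 i * M i (Ordinal jm) = 0.
  by move/rowP/(_ (Ordinal jm)): vM; rewrite !mxE.
have := congr1 (coefp e) vMj; rewrite /= coef0 coef_sum => vMe.
apply: etrans vMe; apply: eq_bigr => i' _.
rewrite coefM (@poly_act_widen _ _ _ (size (v 0 i') + e.+1)) ?leq_addr //.
rewrite (linear_sum (cl j)) /=.
rewrite (big_ord_widen (size (v 0 i') + e.+1)
  (fun a => (v 0 i')`_a * (M i' (Ordinal jm))`_(e - a))) ?leq_addl //.
rewrite [RHS]big_mkcond /=; apply: eq_bigr => a _.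
rewrite linearZ /=; case: ltnP => ae; last first.
  by rewrite gN ?(linear0 (cl j)) ?scaler0 //; lia.
rewrite ME; congr (_ * cl j (g i' _)); lia.
Qed.

Lemma laurent_sub_single B k v : v \in B k -> laurent_sub B (single k v).
Proof.
move=> Bv; split=> [|k']; last by rewrite /single; case: eqP => [->|_]; rewrite ?mem0v.
by exists `|k|%N => k' lt; rewrite /single ifF //; apply/eqP; lia.
Qed.

(** * Finite generation and rank of bounded families *)

Section Bounded.
Variables (B : int -> {vspace V}) (R : nat).
Hypothesis B_full : forall k, k <= 0 -> B k = fullv.
Hypothesis B_zero : forall k, R%:Z < k -> B k = 0%VS.

(** The upper bound is [lin_indep_dim]. A basis of [V] placed at index 0 is independent: the value
    of a combination at [-a] has the coefficients of [t^a] as its coordinates. *)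
Lemma has_rank_bounded : has_rank (laurent_sub B) (\dim {: V}).
Proof.
split; last first.
  move=> m g Mg; have [N gN] := laurent_sub_bound Mg.
  by apply: lin_indep_dim gN _ => // *; exact: memvf.
pose b := vbasis {:V}.
exists (fun i => single 0 b`_i); split=> [i|p].
  by apply: laurent_sub_single; rewrite B_full ?memvf.
move=> /(congr1 (fun f => f (- _))) p0 i; apply/polyP => a; rewrite coef0.
have := p0 a%:Z; rewrite /lincomb.
under eq_bigr do rewrite poly_act_single oppr_le0 lez_nat leq0n sub0r opprK absz_nat.
have /freeP fb : free b by exact: basis_free (vbasisP _).
by move/(fb (fun i => (p i)`_a)).
Qed.

(** The generators span each [B k] with [0 <= k <= R], placed at index [k]. Those at index 0 also
    reach all negative indices through powers of [t], so they get polynomial coefficients and the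
    others constants. *)
Lemma fin_generated_bounded : fin_generated (laurent_sub B).
Proof.
pose T := ('I_R.+1 * 'I_(\dim {:V}))%type.
pose b := vbasis {:V}.
pose g (x : T) := single x.1%:Z (projv (B x.1%:Z) b`_x.2).
exists #|{: T}|, (fun i => g (enum_val i)); split.
  by move=> i; apply: laurent_sub_single; exact: memv_proj.
move=> f [[N fN] fB].
pose p (x : T) : {poly K} :=
  if x.1 == 0 :> nat then \poly_(a < N.+1) coord b x.2 (f (- a%:Z))
  else (coord b x.2 (f x.1%:Z))%:P.
exists (fun i => p (enum_val i)); apply/funext => k.
rewrite /lincomb -(big_enum_val (fun x => poly_act (p x) (g x) k)) /=.
rewrite -(pair_bigA _ (fun x1 x2 => poly_act (p (x1, x2)) (g (x1, x2)) k)) /=.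
(* As [f k] lies in [B k], projecting its basis expansion to [B k] does not change it. *)
have fE : f k = \sum_(j < \dim {:V}) coord b j (f k) *: projv (B k) b`_j.
  rewrite -{1}(projv_id (fB k)) {1}(coord_vbasis (memvf (f k))) linear_sum.
  by apply: eq_bigr => j _; rewrite linearZ.
have [k0|k0] := lerP k 0.
  rewrite big_ord_recl [X in _ = _ + X]big1 => [|i _]; last first.
    apply: big1 => j _; rewrite poly_act_single /p /=.
    case: ifP => // _; rewrite coefC ifF ?scale0r //.
    by apply/eqP; rewrite /bump; lia.
  rewrite addr0 fE; apply: eq_bigr => j _; rewrite poly_act_single k0 /p /=.
  rewrite (B_full k0) (@B_full 0) // coef_poly; congr (_ *: _).
  case: ltnP => lt; first by congr (coord b j (f _)); lia.
  by rewrite fN ?linear0 //; lia.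
have [Rk|kR] := ltrP R%:Z k.
  rewrite big1 => [|i _].
    by apply/eqP; rewrite -memv0 -(B_zero Rk).
  apply: big1 => j _; rewrite poly_act_single ifF //=.
  by have := ltn_ord i; lia.
have lt : (`|k| < R.+1)%N by lia.
have kE : k = (`|k|%N)%:Z by lia.
rewrite (bigD1 (Ordinal lt)) //= [X in _ = _ + X]big1 => [|i /eqP ne]; last first.
  apply: big1 => j _; rewrite poly_act_single /p /=.
  case: ifP => // le; rewrite ifF; last by apply/eqP; lia.
  rewrite coefC ifF ?scale0r //; apply/eqP => e; apply: ne; apply: val_inj => /=.
  by lia.
rewrite addr0 fE; apply: eq_bigr => j _; rewrite poly_act_single /p /= -kE lexx subrr.
by rewrite ifF ?coefC //; apply/eqP; lia.
Qed.

End Bounded.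

(** The generators have bounded support and [t] only lowers the index, so no monomial above their
    common bound is generated. *)
Lemma fin_generated_vanish B : fin_generated (laurent_sub B) ->
  exists N : nat, forall k, N%:Z < k -> B k = 0%VS.
Proof.
move=> [n [g [Mg gen]]]; have [N gN] := laurent_sub_bound Mg.
exists N => k Nk; apply/eqP; rewrite -subv0; apply/subvP => v Bv; rewrite memv0.
have [p /(congr1 (fun f => f k))] := gen _ (laurent_sub_single Bv).
rewrite /single eqxx => ->; rewrite /lincomb big1 // => i _.
by rewrite /poly_act big1 // => j _; rewrite gN ?scaler0 //; lia.
Qed.

Section Decreasing.
Variable B : int -> {vspace V}.
Hypothesis B_dec : forall k, (B (k + 1) <= B k)%VS.

Lemma dec_subv k m : k <= m -> (B m <= B k)%VS.
Proof.
move=> km; have -> : m = k + (`|m - k|%N)%:Z by lia.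
elim: `|m - k|%N => [|n IH]; first by rewrite addr0.
by apply: subv_trans IH; rewrite -addn1 PoszD addrA.
Qed.

(** A maximal independent family is supported in some [[-N, N]], so all its values lie in [B (- N)];
    [lin_indep_dim] then forces this space to be full. *)
Lemma has_rank_full : has_rank (laurent_sub B) (\dim {: V}) ->
  exists N : nat, forall k, k <= - N%:Z -> B k = fullv.
Proof.
move=> [[g [Mg ind]] _]; have [N gN] := laurent_sub_bound Mg.
have le : (\dim {:V} <= \dim (B (- N%:Z)))%N.
  apply: (lin_indep_dim gN) => // i k.
  have [lt|kN] := ltnP N `|k|%N; first by rewrite gN ?mem0v.
  by apply: subvP ((Mg i).2 k); apply: dec_subv; lia.
exists N => k kN; apply/eqP; rewrite eqEdim subvf (leq_trans le) //.
by apply: dimvS; exact: dec_subv.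
Qed.

End Decreasing.
End LaurentModules.

(** * Weights and admissible ideals *)

Lemma sum_int_widen (F : int -> int) (L : int) (n : nat) :
  (forall k, k < L -> F k = 0) -> (forall k, L + n%:Z <= k -> F k = 0) ->
  \sum_(k \in [set: int]) F k = \sum_(j < n) F (L + j%:Z).
Proof.
move=> Flt Fge; rewrite (fsbigE [seq L + j%:Z | j <- iota 0 n]) //.
- rewrite big_map -(big_mkord xpredT (fun j => F (L + j%:Z))) /index_iota subn0.
  by apply: eq_bigl => j; rewrite in_setT.
- by rewrite map_inj_uniq ?iota_uniq // => i j /addrI [].
move=> k _ kn; have [kL|Lk] := ltrP k L; first exact: Flt.
have [kn'|nk] := ltrP k (L + n%:Z); last exact: Fge.
case/mapP: kn; exists `|k - L|%N; last by lia.
by rewrite mem_iota; lia.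
Qed.

Lemma sum_nat_widen (F : nat -> int) (n : nat) :
  (forall k, (n < k)%N -> F k = 0) ->
  \sum_(k \in [set k : nat | (1 <= k)%N]) F k = \sum_(j < n) F j.+1.
Proof.
move=> F0; rewrite (fsbigE (iota 1 n)) ?iota_uniq //.
- rewrite (iotaDl 1 0) big_map -(big_mkord xpredT (fun j => F j.+1)).
  rewrite /index_iota subn0; apply: eq_bigl => j; apply/asboolP; exact: leq0n.
- by move=> k /=; rewrite mem_iota => /andP[].
move=> k /= k1; rewrite mem_iota k1 /= => kn; apply: F0; lia.
Qed.

Lemma sum_by_parts (d : int -> int) (L : int) (n : nat) :
  \sum_(j < n) (L + j%:Z) * (d (L + j%:Z) - d (L + j%:Z + 1)) =
  L * d L + \sum_(j < n) d (L + j.+1%:Z) - (L + n%:Z) * d (L + n%:Z).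
Proof.
elim: n => [|n IH]; first by rewrite !big_ord0 !addr0 subrr.
rewrite !big_ord_recr /= IH -addn1 !PoszD !addrA; ring.
Qed.

Section Weights.
Variables (K : fieldType) (A : graded_algebra K).

(** Abel summation; the boundary term at [L + n] vanishes with [B i (L + n)]. *)
Lemma tc_weightE (B : test_configuration A) (i : nat) (L : int) (n : nat) :
  (forall k, k <= L -> B i k = fullv) ->
  (forall k, L + n%:Z <= k -> B i k = 0%VS) ->
  tc_weight B i = L * (\dim {: A i})%:Z +
                  \sum_(j < n) (\dim (B i (L + j.+1%:Z)))%:Z.
Proof.
move=> Bfull B0; pose d k : int := (\dim (B i k))%:Z.
rewrite /tc_weight (@sum_int_widen _ L n) => [|k kL|k kn].
- rewrite (sum_by_parts d) /d Bfull // (B0 (L + n%:Z)) // dimv0 mulr0 subr0.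
  by [].
- by rewrite !Bfull ?subrr ?mulr0 //; lia.
- by rewrite !B0 ?subrr ?mulr0 //; lia.
Qed.

Lemma filt_weightE r (V : filtration (A 1%N) r) (i n : nat) :
  (forall k, (n < k)%N -> adm_ideal V k i = 0%VS) ->
  filt_weight V i = \sum_(j < n) (\dim (adm_ideal V j.+1 i))%:Z.
Proof.
move=> V0; rewrite /filt_weight (@sum_nat_widen _ n) // => k /V0 ->.
by rewrite dimv0.
Qed.

End Weights.

(** * Multiplicativity of admissible ideals *)

Section AdmissibleIdeals.
Variables (K : fieldType) (A : graded_algebra K).

HB.instance Definition _ i j l (e : (i + j)%N = l) (x : A i) :=
  GRing.isLinear.Build K (A j) (A l) *:%R (gmul e x) (gmul_linr e x).

(** The product with its right factor fixed is named so that it can carry a linear structure in the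
    left factor. *)
Definition gmulR i j l (e : (i + j)%N = l) (y : A j) (x : A i) : A l := gmul e x y.

HB.instance Definition _ i j l (e : (i + j)%N = l) (y : A j) :=
  GRing.isLinear.Build K (A i) (A l) *:%R (gmulR e y) (gmul_linl e y).

Lemma gmul_memv i j l (e : (i + j)%N = l) (U : {vspace A i}) (W : {vspace A j})
    (Z : {vspace A l}) (sU : seq (A i)) (sW : seq (A j)) :
  (U <= <<sU>>)%VS -> (W <= <<sW>>)%VS ->
  (forall u w, u \in sU -> w \in sW -> gmul e u w \in Z) ->
  forall u w, u \in U -> w \in W -> gmul e u w \in Z.
Proof.
move=> UsU WsW sZ.
have half u : u \in sU -> forall w, w \in W -> gmul e u w \in Z.
  move=> su w; rewrite -(lfunE (gmul e u)) memv_preim; apply: subvP.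
  apply: subv_trans WsW _; apply/span_subvP => w' sw'.
  by rewrite -memv_preim lfunE; exact: sZ.
move=> u w Uu Ww; move: u Uu => u; rewrite -[gmul e u w]/(gmulR e w u).
rewrite -(lfunE (gmulR e w)) memv_preim; apply: subvP.
apply: subv_trans UsU _; apply/span_subvP => u' su'.
by rewrite -memv_preim lfunE; exact: half.
Qed.

Lemma mem_prod_space i j l (e : (i + j)%N = l) (U : {vspace A i})
    (W : {vspace A j}) u w : u \in U -> w \in W -> gmul e u w \in prod_space e U W.
Proof.
apply: (@gmul_memv _ _ _ _ _ _ _ (vbasis U) (vbasis W)) => [||u' w' Uu Ww].
- by rewrite (span_basis (vbasisP U)).
- by rewrite (span_basis (vbasisP W)).
- by apply: memv_span; apply/allpairsP; exists (u', w').
Qed.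

Lemma prod_space_sub i j l (e : (i + j)%N = l) (U : {vspace A i})
    (W : {vspace A j}) (Z : {vspace A l}) :
  (forall u w, u \in U -> w \in W -> gmul e u w \in Z) ->
  (prod_space e U W <= Z)%VS.
Proof.
move=> UWZ; apply/span_subvP => _ /allpairsP[[u w] [/vbasis_mem Uu /vbasis_mem Ww ->]].
exact: UWZ.
Qed.

Variables (r : nat) (V : filtration (A 1%N) r).

(** A first letter of weight [a] is put in front of each index tuple. Together with [adm_ideal_sub]
    this describes the ideals recursively in the degree. *)
Lemma adm_ideal_cons a k n v x : v \in V a -> x \in adm_ideal V k n ->
  gmul (add1n n) v x \in adm_ideal V (a + k) n.+1.
Proof.
(* Index tuples only take values up to [r]; beyond that, [V a] is zero. *)
move=> Va; have [ar|ra] := leqP a r; last first.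
  move: Va; rewrite filt_gt // memv0 => /eqP ->.
  by rewrite -[gmul _ _ _]/(gmulR (add1n n) x 0) linear0 mem0v.
rewrite -(lfunE (gmul (add1n n) v)) memv_preim; apply: subvP.
apply/subv_sumP => ks kks; apply/subvP => y ksy; rewrite -memv_preim lfunE /=.
pose a' : 'I_r.+1 := Ordinal (ar : (a < r.+1)%N).
pose ks' := [ffun i => if unlift ord0 i is Some j then ks j else a'].
have ks'0 : ks' ord0 = a' by rewrite ffunE unlift_none.
have ks'S j : ks' (lift ord0 j) = ks j by rewrite ffunE liftK.
have leks : (a + k <= \sum_i ks' i)%N.
  rewrite big_ord_recl ks'0 leq_add2l.
  by under eq_bigr do rewrite ks'S.
apply: subvP (sumv_sup _ leks (subvv _)) _ _.
rewrite /= ks'0 /=; have -> : (fun i => ks' (lift ord0 i) : nat) = (fun i => ks i : nat).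
  by apply/funext => j; rewrite ks'S.
exact: mem_prod_space.
Qed.

Lemma adm_ideal_sub k n (Z : {vspace A n.+1}) :
  (forall a k' v x, (k <= a + k')%N -> v \in V a -> x \in adm_ideal V k' n ->
     gmul (add1n n) v x \in Z) ->
  (adm_ideal V k n.+1 <= Z)%VS.
Proof.
move=> H; apply/subv_sumP => ks; rewrite big_ord_recl => kks.
apply: prod_space_sub => v x Vv ksx; apply: H kks Vv _.
pose ks' : {ffun 'I_n -> 'I_r.+1} := [ffun i => ks (lift ord0 i)].
have leks : (\sum_(i < n) ks (lift ord0 i) <= \sum_i ks' i)%N.
  by under [leqRHS]eq_bigr do rewrite ffunE.
apply: subvP (sumv_sup _ leks (subvv _)) _ _.
congr (x \in filt_prod V _): ksx.
by apply/funext => j; rewrite ffunE.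
Qed.

Lemma adm_ideal_mono k m n : (k <= m)%N -> (adm_ideal V m n <= adm_ideal V k n)%VS.
Proof.
move=> km; apply/subv_sumP => ks mks.
exact: sumv_sup (leq_trans km mks) (subvv _).
Qed.

Lemma adm_ideal_gt k n : (n * r < k)%N -> adm_ideal V k n = 0%VS.
Proof.
move=> lt; rewrite /adm_ideal big_pred0 // => ks; apply/negbTE; rewrite -ltnNge.
apply: leq_ltn_trans lt; rewrite -[n in (n * _)%N]card_ord -sum_nat_const.
by apply: leq_sum => i _; rewrite -ltnS.
Qed.

Lemma adm_ideal_deg0 : adm_ideal V 0 0 = fullv.
Proof.
apply/eqP; rewrite eqEsubv subvf; apply/subvP => x _.
pose ks0 : {ffun 'I_0 -> 'I_r.+1} := [ffun=> ord0].
have le0 : (0 <= \sum_i ks0 i)%N by [].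
apply: subvP (sumv_sup ks0 le0 (subvv _)) _ _ => /=.
by have [c ->] := gconnected x; apply: memvZ; exact: memv_line.
Qed.

Lemma filt_adm_ideal1 k : (V k <= adm_ideal V k 1)%VS.
Proof.
apply/subvP => v Vv; rewrite -(gmul1r (addn0 1) v) -[k]addn0.
rewrite (Prop_irrelevance (addn0 1) (add1n 0)).
by apply: adm_ideal_cons => //; rewrite adm_ideal_deg0 memvf.
Qed.

(** Induction on the left degree: split the first linear factor off [x], reassociate, and put it
    back in front by [adm_ideal_cons]. *)
Lemma adm_ideal_mul i j l (e : (i + j)%N = l) k m x y :
  x \in adm_ideal V k i -> y \in adm_ideal V m j ->
  gmul e x y \in adm_ideal V (k + m) l.
Proof.
elim: i j l e k m x y => [|i IH] j l e k m x y.
  (* In degree 0 only weight 0 survives, and there [x] is a scalar. *)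
  case: k => [|k]; last first.
    rewrite adm_ideal_gt // memv0 => /eqP ->.
    by rewrite -[gmul _ _ _]/(gmulR e y 0) linear0 mem0v.
  have [c ->] := gconnected x; have jl : j = l by rewrite -e.
  case: _ / jl e => e.
  rewrite -[gmul _ _ _]/(gmulR e y _) linearZ /= /gmulR gmul1l => _ Iy.
  exact: memvZ.
move=> + Iy; rewrite -[gmul e x y]/(gmulR e y x) -(lfunE (gmulR e y)) memv_preim.
apply: subvP; apply: adm_ideal_sub => a k' v x' le Vv Ix'.
rewrite -memv_preim lfunE /= /gmulR.
have ijl : (i + j).+1 = l by rewrite -e.
case: _ / ijl e => e; rewrite (gmulA (add1n i) _ (erefl (i + j)%N) (add1n (i + j)%N)).
have := adm_ideal_cons Vv (IH j _ (erefl _) k' m x' y Ix' Iy).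
by apply: subvP; apply: adm_ideal_mono; rewrite addnA leq_add2r.
Qed.

End AdmissibleIdeals.

(** * The homogeneous coordinate ring *)

(** Phrased with a test subspace [Z], so that inductive membership proofs apply it directly. *)
Definition generated_in_degree1 (K : fieldType) (A : graded_algebra K) :=
  forall n (Z : {vspace A n.+1}),
    (forall (v : A 1%N) (x : A n), gmul (add1n n) v x \in Z) -> Z = fullv.

(** Vanishing of the socle, tested on homogeneous elements. It lets a nonzero element be pushed up
    to degree [q]. *)
Definition socle_free (K : fieldType) (A : graded_algebra K) :=
  forall n (x : A n), x != 0 -> exists f : A 1%N, gmul (addn1 n) x f != 0.

Section CoordinateRing.
Variables (K : fieldType) (S : comAlgType K) (G : standard_grading S).

(** If [p] contained all linear forms, every element would be constant modulo [p], since linear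
    forms generate [S]. Homogeneity of [p] would then put every element of positive degree in [p],
    against relevance. *)
Lemma proj_coordinate (p : Proj G) : exists2 f, G 1%N f & ~ p f.
Proof.
apply: contrapT => nof; have allp f : G 1%N f -> p f.
  by move=> Gf; apply: contrapT => npf; apply: nof; exists f.
have [r [x [Gx gen]]] := gr_gen G; have Pp := ptP p.
have ptN a : p a -> p (- a) by move=> pa; rewrite -mulN1r; exact: pt_mul Pp _ _ pa.
have modp : forall a, exists c : K, p (a - c%:A).
  apply: gen => [i|c|a b [c pa] [d pb]|a b [c pa] [d pb]].
  - by exists 0; rewrite scale0r subr0; exact: allp.
  - by exists c; rewrite subrr; exact: pt_zero Pp.
  - by exists (c + d); rewrite scalerDl opprD addrACA; exact: pt_add Pp _ _ pa pb.
  exists (c * d).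
  have -> : a * b - (c * d)%:A = b * (a - c%:A) + c%:A * (b - d%:A).
    by rewrite -scalerA -mulr_algl; ring.
  by apply: (pt_add Pp); apply: (pt_mul Pp).
have [n [a [n0 [Ga]]]] := pt_relevant Pp; apply.
have [c pac] := modp a.
(* The homogeneous components of [a - c], in degrees [n > 0] and 0. *)
pose h (i : nat) : S := if i == n then a else if i == 0%N then - c%:A else 0.
have Gh i : G i (h i).
  rewrite /h; case: eqP => [->//|_]; case: eqP => [->|_]; last exact: gr_zero.
  rewrite -scaleNr -[_ *: _]addr0; apply: gr_lin; [exact: gr_one|exact: gr_zero].
have ph : p (\sum_(i < n.+1) h i).
  rewrite big_ord_recr /= {2}/h eqxx; case: n n0 @h {Ga Gh} => // n _ /=.
  rewrite big_ord_recl big1 => [|i _]; last first.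
    by rewrite ifF //; apply/eqP; rewrite /= /bump; have := ltn_ord i; lia.
  by rewrite /= addr0 addrC.
by have := pt_homog Pp Gh ph (ltnSn n); rewrite /h eqxx.
Qed.

Lemma linear_regular f : G 1%N f ->
  @regular K S G 1 (whole (Proj G)) (fun q _ => loc_of (stalk_mulset q) f).
Proof.
move=> Gf p _; exists (whole _); split=> //; exists 0%N, f, 1.
split=> [||q _ _]; [by rewrite add0n | exact: gr_one |].
by exists (mset1 (stalk_mulset q)).
Qed.

Lemma at_pt_inj n (s t : OProj G n (whole (Proj G))) :
  (forall p, at_pt s p = at_pt t p) -> s = t.
Proof.
move=> st; apply: osec_inj => p Up.
by rewrite (Prop_irrelevance Up I); exact: st.
Qed.

(** [f] is a unit in the stalk at [p], since it may be absorbed into the multiplier [f * h]. *)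
Lemma loc_regular (p : Proj G) (z : hloc p) (f : S) : homogeneous G f -> ~ p f ->
  z * loc_of (stalk_mulset p) f = 0 -> z = 0.
Proof.
move=> hf pf; elim/locW: z => a g Mg.
rewrite [_ * _]loc_mulE -[0]/(loc_of _ 0) => /fracP[h Mh].
rewrite mul0r !mulr0 !mulr1 => e; apply/fracP; exists (f * h).
  exact: (@msetM _ (stalk_mulset p)).
by rewrite mul0r mulr0 mulr1 -e; ring.
Qed.

Variables (A : graded_algebra K) (phi : forall n, A n -> OProj G n (whole (Proj G))).
Hypothesis phiP : is_coordinate_ring phi.

Lemma at_pt_phi0 n p : at_pt (phi (0 : A n)) p = 0.
Proof.
have := cr_linear phiP 1 (0 : A n) 0 p.
rewrite !scale1r addr0 -[loc_of _ 1]/(1 : hloc p) mul1r => /eqP.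
by rewrite -subr_eq0 opprD addrA subrr add0r oppr_eq0 => /eqP.
Qed.

Lemma at_pt_phi_sum n m (c : 'I_m -> K) (z : 'I_m -> A n) p :
  at_pt (phi (\sum_j c j *: z j)) p =
  \sum_j loc_of _ (c j)%:A * at_pt (phi (z j)) p.
Proof.
elim: m c z => [|m IH] c z; first by rewrite !big_ord0 at_pt_phi0.
by rewrite !big_ord_recl (cr_linear phiP) IH.
Qed.

Fixpoint word_prod n : ('I_n -> A 1%N) -> A n :=
  match n with
  | 0 => fun _ => gone A
  | n'.+1 => fun y => gmul (add1n n') (y ord0) (word_prod (fun i => y (lift ord0 i)))
  end.

Lemma at_pt_word_prod n (y : 'I_n -> A 1%N) p :
  at_pt (phi (word_prod y)) p = \prod_(i < n) at_pt (phi (y i)) p.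
Proof.
elim: n y => [|n IH] y; first by rewrite big_ord0 (cr_one phiP).
by rewrite big_ord_recl /= (cr_mul phiP) IH.
Qed.

(** In degree 1 a section is itself a word of length one, so [A_1] is all of [Gamma(Y, O(1))]. *)
Lemma phi1_surj (u : OProj G 1 (whole (Proj G))) : exists y : A 1%N, phi y = u.
Proof.
apply/(cr_image phiP); exists 1%N, (fun=> 1), (fun _ _ => u) => p.
by rewrite !big_ord1 scale1r -[loc_of _ 1]/(1 : hloc p) mul1r.
Qed.

(** Sections in the image of [Sym] are combinations of words in sections of [O(1)]. These lift to
    [A_1], and injectivity of [phi] carries the identity back to [A]. *)
Lemma coordinate_ring_generated : generated_in_degree1 A.
Proof.
move=> n Z VZ; apply/eqP; rewrite eqEsubv subvf; apply/subvP => x _.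
have /(cr_image phiP)[m [c [u uE]]] : exists x', phi x' = phi x by exists x.
have /choice[y yE] := fun ji => phi1_surj (u ji.1 ji.2).
suff -> : x = \sum_j c j *: word_prod (fun i => y (j, i)).
  by apply: memv_suml => j _; apply: memvZ; exact: VZ.
apply: (cr_inj phiP); apply: at_pt_inj => p; rewrite uE at_pt_phi_sum.
apply: eq_bigr => j _; rewrite at_pt_word_prod; congr (_ * _).
by apply: eq_bigr => i _; rewrite yE.
Qed.

(** Choose a point where [phi x] has nonzero germ and a linear form not vanishing there; the form is
    regular on the stalk, so the product stays nonzero. *)
Lemma coordinate_ring_socle_free : socle_free A.
Proof.
move=> n x /eqP x0.
have [p px] : exists p, at_pt (phi x) p <> 0.
  apply: contrapT => nop; apply: x0; apply: (cr_inj phiP); apply: at_pt_inj => p.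
  by rewrite at_pt_phi0; apply: contrapT => px; apply: nop; exists p.
have [f Gf pf] := proj_coordinate p.
have [y yE] := phi1_surj (MkOsec (linear_regular Gf)).
exists y; apply/eqP => xy; apply: px.
have := cr_mul phiP (addn1 n) x y p; rewrite xy at_pt_phi0 yE => /esym.
by apply: loc_regular => //; exists 1%N.
Qed.

End CoordinateRing.

(** * From filtrations to test configurations *)

Section Truncation.
Variables (K : fieldType) (A : graded_algebra K) (q : nat).

HB.instance Definition _ i :=
  GRing.isLinear.Build K (tpiece A q i) (A i) *:%R (@tlift K A q i)
    (@tlift_linear K A q i).

HB.instance Definition _ i :=
  GRing.isLinear.Build K (A i) (tpiece A q i) *:%R (@tproj K A q i)
    (@tproj_linear K A q i).

(** Subspaces move between [A] and its truncation along linear maps, because the type [tpiece A q i]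
    depends on the test [i <= q]. *)
Definition trunc_img i (U : {vspace A i}) : {vspace truncation A q i} :=
  (linfun (@tproj K A q i) @: U)%VS.

Definition lift_img i (U : {vspace truncation A q i}) : {vspace A i} :=
  (linfun (@tlift K A q i) @: U)%VS.

(** These pieces are zero, so conditions in degrees above [q] hold for free. *)
Lemma truncation_gt i (U W : {vspace truncation A q i}) : (q < i)%N -> U = W.
Proof.
move=> qi; have U0 (Z : {vspace truncation A q i}) : Z = 0%VS.
  apply/eqP; rewrite -subv0; apply/subvP => x _; rewrite memv0; apply/eqP.
  by have := tliftK x; rewrite tproj_gt.
by rewrite (U0 U) (U0 W).
Qed.

Lemma dim_truncation i : (i <= q)%N -> \dim {: truncation A q i} = \dim {: A i}.
Proof. by move=> iq; rewrite /= /tpiece iq. Qed.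

Lemma dim_trunc_img i (U : {vspace A i}) : (i <= q)%N -> \dim (trunc_img U) = \dim U.
Proof.
move=> iq; apply: limg_dim_eq; apply/eqP; rewrite -subv0.
apply: subv_trans (capvSr _ _) _; rewrite subv0; apply/lker0P => x y.
by rewrite !lfunE; exact: can_inj (tprojK iq) _ _.
Qed.

Lemma trunc_img_full i : trunc_img {: A i} = fullv.
Proof.
apply/eqP; rewrite eqEsubv subvf; apply/subvP => x _.
rewrite -(tliftK x) -[tproj q _](lfunE (@tproj K A q i)); exact/memv_img/memvf.
Qed.

Lemma dim_lift_img i (U : {vspace truncation A q i}) : \dim (lift_img U) = \dim U.
Proof.
apply: limg_dim_eq; apply/eqP; rewrite -subv0.
apply: subv_trans (capvSr _ _) _; rewrite subv0; apply/lker0P => x y.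
by rewrite !lfunE; exact: can_inj (@tliftK K A q i) _ _.
Qed.

Lemma lift_img_full i : (i <= q)%N -> lift_img {: truncation A q i} = fullv.
Proof.
by move=> iq; apply/eqP; rewrite eqEdim subvf dim_lift_img dim_truncation ?leqnn.
Qed.

Lemma lift_img_eqfull i (U : {vspace truncation A q i}) :
  (i <= q)%N -> lift_img U = fullv -> U = fullv.
Proof.
move=> iq e; apply/eqP; rewrite eqEdim subvf dim_truncation //.
by rewrite -dim_lift_img e leqnn.
Qed.

Lemma mem_trunc_img i (U : {vspace A i}) x : x \in U -> tproj q x \in trunc_img U.
Proof. by move=> /(memv_img (linfun (@tproj K A q i))); rewrite lfunE. Qed.

End Truncation.

Section FiltrationConfiguration.
Variables (K : fieldType) (A : graded_algebra K).
Hypothesis A_gen : generated_in_degree1 A.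
Variables (r : nat) (V : filtration (A 1%N) r).

Lemma adm_ideal_full n : adm_ideal V 0 n = fullv.
Proof.
elim: n => [|n IH]; first exact: adm_ideal_deg0.
apply: A_gen => v x; apply: (@adm_ideal_cons _ _ _ _ 0%N 0%N).
  by rewrite filt0 memvf.
by rewrite IH memvf.
Qed.

(** The positive part, which extends the indexing of the ideals from naturals to integers. *)
Definition int_pos (k : int) : nat := if k is Posz n then n else 0%N.

Lemma int_pos_leq k n : (int_pos k <= n)%N = (k <= n%:Z).
Proof. by case: k. Qed.

Lemma int_pos_le0 k : k <= 0 -> int_pos k = 0%N.
Proof. by rewrite -int_pos_leq leqn0 => /eqP. Qed.

Variable q : nat.

Definition filt_tc_space i (k : int) : {vspace truncation A q i} :=
  trunc_img q (adm_ideal V (int_pos k) i).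

Lemma filt_tc_full i k : k <= 0 -> filt_tc_space i k = fullv.
Proof.
by move=> k0; rewrite /filt_tc_space int_pos_le0 // adm_ideal_full trunc_img_full.
Qed.

Lemma filt_tc_zero i k : (i * r)%:Z < k -> filt_tc_space i k = 0%VS.
Proof.
move=> ltk; rewrite /filt_tc_space adm_ideal_gt; first exact: limg0.
by case: k ltk.
Qed.

Lemma filt_tc_t i k : (filt_tc_space i (k + 1) <= filt_tc_space i k)%VS.
Proof.
apply: limgS; apply: adm_ideal_mono; rewrite int_pos_leq.
by apply: (@le_trans _ _ (k + 1)); [lia | rewrite -int_pos_leq].
Qed.

Lemma filt_tc_one : gone (truncation A q) \in filt_tc_space 0 0.
Proof. by rewrite filt_tc_full ?memvf. Qed.

Lemma filt_tc_mul i j l (e : (i + j)%N = l) k m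
    (x : truncation A q i) (y : truncation A q j) :
  x \in filt_tc_space i k -> y \in filt_tc_space j m ->
  gmul e x y \in filt_tc_space l (k + m).
Proof.
have [lq|ql] := leqP l q; last first.
  by move=> _ _; rewrite (truncation_gt (filt_tc_space l (k + m)) fullv ql) memvf.
move=> /memv_imgP[x' Ix ->] /memv_imgP[y' Iy ->]; rewrite !lfunE /= /tmul.
rewrite !tprojK; try by lia.
apply: mem_trunc_img; apply: subvP (adm_ideal_mul e Ix Iy).
(* The positive part is subadditive. *)
apply: adm_ideal_mono.
by rewrite int_pos_leq PoszD lerD // -int_pos_leq.
Qed.

Definition filt_tc : test_configuration (truncation A q) :=
  TestConfiguration filt_tc_t filt_tc_one filt_tc_mul
    (fun i => fin_generated_bounded (@filt_tc_full i) (@filt_tc_zero i))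
    (fun i => has_rank_bounded (@filt_tc_full i)).

Lemma filt_tc_futaki i : (i <= q)%N -> tc_futaki filt_tc i = filt_futaki V i.
Proof.
move=> iq; rewrite /tc_futaki /filt_futaki dim_truncation //; congr (futaki _ _ _).
(* The last possibly nonzero index is [i * r]; the successor is needed because [tc_weightE] asks for
   vanishing at [L + n] itself. *)
rewrite (@tc_weightE _ _ filt_tc i 0 (i * r).+1) => [|k|k].
- rewrite (@filt_weightE _ _ _ _ _ (i * r).+1) => [|k lt]; last first.
    by apply: adm_ideal_gt; lia.
  rewrite mul0r add0r; apply: eq_bigr => j _.
  by rewrite add0r [tc _ _ _]/(filt_tc_space _ _) dim_trunc_img.
- exact: filt_tc_full.
- by rewrite add0r => le; apply: filt_tc_zero; lia.
Qed.

(** A slope [l <= 0] would kill [V r], and a slope [l > 0] would make [V 1] full. *)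
Lemma filt_tc_nontrivial : (0 < q)%N -> ~ tc_trivial filt_tc.
Proof.
move=> q0 [l /(_ 1%N) triv].
(* The remaining factor has degree 0, hence weight 0, and is a scalar. *)
have sub1 k : (adm_ideal V k 1 <= V k)%VS.
  apply: adm_ideal_sub => a [|k'] v x le Va; last first.
    by rewrite adm_ideal_gt // memv0 => /eqP ->; rewrite linear0 mem0v.
  have [c ->] := gconnected x => _.
  rewrite linearZ /= memvZ // gmul1r; move: Va; apply: subvP.
  rewrite addn0 in le; elim: a le => [|a IH]; first by rewrite leqn0 => /eqP ->.
  by rewrite leq_eqVlt => /predU1P[->//|] /IH; apply: subv_trans; exact: filt_dec.
have dimB (k : nat) : \dim (filt_tc 1 k%:Z) = \dim (adm_ideal V k 1).
  exact: dim_trunc_img.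
have [l0|l0] := lerP l 0.
  have r0 := filt_r V; have Br : filt_tc 1 r%:Z = 0%VS by apply: (triv r%:Z).2; lia.
  move: (dimB r); rewrite Br dimv0 => /esym/eqP; rewrite dimv_eq0 -subv0 => sub.
  move: (filt_last V); rewrite -subv0 => /negP; apply.
  by apply: subv_trans sub; exact: filt_adm_ideal1.
have B1 : filt_tc 1 1%:Z = fullv by apply: (triv 1%:Z).1; lia.
move: (dimB 1%N); rewrite B1 dim_truncation // => e.
move: (filt1 V) => /eqP; apply; apply/eqP; rewrite eqEdim subvf /= e.
exact: dimvS (sub1 1%N).
Qed.

End FiltrationConfiguration.

Lemma futaki_lt (w w' : int) (n d n' d' : nat) : (0 < n * d)%N -> (0 < n' * d')%N ->
  (futaki w n d < futaki w' n' d')%E = (w * (n' * d')%N%:Z < w' * (n * d)%N%:Z).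
Proof.
move=> nd nd'; rewrite /futaki !ifF; try by apply/eqP; lia.
rewrite lte_fin ltr_pdivrMr ?ltr0n // mulrAC ltr_pdivlMr ?ltr0n //.
by rewrite !pmulrn -!intrM ltr_int.
Qed.

(** * From test configurations to filtrations *)

Section HilbertStability.
Variables (K : fieldType) (A : graded_algebra K).
Hypotheses (A_gen : generated_in_degree1 A) (A_socle : socle_free A).

(** Repeated multiplication starting from 1. Thus Futaki values in positive degrees are finite and
    can be compared by cross-multiplying. *)
Lemma dim_piece_gt0 n : (0 < \dim {: A n})%N.
Proof.
suff [x x0] : exists x : A n, x != 0.
  rewrite lt0n dimv_eq0; apply: contra_neq x0 => f0.
  by apply/eqP; rewrite -memv0 -f0 memvf.
elim: n => [|n [x /A_socle[f xf]]]; first by exists (gone A); exact: gone_neq0.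
by exists (gmul (addn1 n) x f).
Qed.

(** * Slope and weights of a test configuration *)

Section Configuration.
Variables (q : nat) (B : test_configuration (truncation A q)).
Hypothesis q_gt0 : (0 < q)%N.

Definition lift_tc i (k : int) : {vspace A i} := lift_img (B i k).

Lemma lift_tc_mono i k m : k <= m -> (lift_tc i m <= lift_tc i k)%VS.
Proof. by move=> km; apply: limgS; exact: (dec_subv (@tc_t _ _ B i)) km. Qed.

Lemma lift_tc_one : gone A \in lift_tc 0 0.
Proof.
have -> : gone A = linfun (@tlift K A q 0) (gone (truncation A q)).
  by rewrite lfunE /= /tone tprojK.
exact: memv_img (tc_one B).
Qed.

Lemma lift_tc_mul i j l (e : (i + j)%N = l) k m x y : (l <= q)%N ->
  x \in lift_tc i k -> y \in lift_tc j m -> gmul e x y \in lift_tc l (k + m).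
Proof.
move=> lq /memv_imgP[x' Bx ->] /memv_imgP[y' By ->]; rewrite !lfunE /=.
have -> : gmul e (tlift x') (tlift y') = linfun (@tlift K A q l) (tmul e x' y').
  by rewrite lfunE /= /tmul tprojK.
exact: memv_img (@tc_mul _ _ B _ _ _ e _ _ _ _ Bx By).
Qed.

Lemma lift_tc_jump : exists l, lift_tc 1 l = fullv /\ lift_tc 1 (l + 1) != fullv.
Proof.
have [N BN] := has_rank_full (@tc_t _ _ B 1) (tc_rank B 1).
have [M BM] := fin_generated_vanish (tc_fg B 1).
pose P n := lift_tc 1 (- N%:Z + n%:Z) != fullv.
have exP : exists n, P n.
  exists (N + M).+1; rewrite /P /lift_tc BM; last by lia.
  by rewrite /lift_img limg0 eq_sym -dimv_eq0 -lt0n dim_piece_gt0.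
(* Index [-N] is full, so the least non-full index has a predecessor, which is the last full one. *)
case: (ex_minnP exP) => -[|n] Pn min.
  by move: Pn; rewrite /P /lift_tc BN ?lift_img_full ?eqxx //; lia.
exists (- N%:Z + n%:Z); split.
  by apply/eqP; apply: contraT => /min; rewrite ltnn.
by move: Pn; rewrite /P -[n.+1]addn1 PoszD addrA.
Qed.

Variable l : int.
Hypothesis B1_full : lift_tc 1 l = fullv.

Lemma lift_tc_full n : (n <= q)%N -> lift_tc n (n%:Z * l) = fullv.
Proof.
elim: n => [|n IH] nq.
  apply/eqP; rewrite eqEsubv subvf; apply/subvP => x _.
  by have [c ->] := gconnected x; rewrite memvZ // mul0r lift_tc_one.
apply: A_gen => v x; have -> : n.+1%:Z * l = l + n%:Z * l.
  by rewrite -add1n PoszD mulrDl mul1r.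
by apply: lift_tc_mul; rewrite ?B1_full ?IH ?memvf // ltnW.
Qed.

Lemma tc_full n k : (n <= q)%N -> k <= n%:Z * l -> B n k = fullv.
Proof.
move=> nq kl; apply: (lift_img_eqfull nq); apply/eqP; rewrite eqEsubv subvf.
by rewrite -(lift_tc_full nq) lift_tc_mono.
Qed.

(** Valid for every large [m], so that degrees 1 and [q] can use sums of the same length. *)
Lemma tc_weight_shift n : (n <= q)%N -> exists M : nat, forall m, (M <= m)%N ->
  tc_weight B n = n%:Z * l * (\dim {: A n})%:Z +
    \sum_(j < m) (\dim (lift_tc n (n%:Z * l + j.+1%:Z)))%:Z.
Proof.
move=> nq; have [N BN] := fin_generated_vanish (tc_fg B n).
exists `|(n%:Z * l - N%:Z - 1)%R|%N => m Mm.
rewrite (@tc_weightE _ _ B n (n%:Z * l) m) => [|k|k le].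
- by rewrite dim_truncation //; under [in RHS]eq_bigr do rewrite dim_lift_img.
- exact: tc_full.
- by apply: BN; lia.
Qed.

Lemma tc_futaki_lt :
  tc_weight B 1 * (q * \dim {: A q})%N%:Z < tc_weight B q * (\dim {: A 1%N})%:Z ->
  (tc_futaki B 1 < tc_futaki B q)%E.
Proof.
move=> lt; rewrite /tc_futaki !dim_truncation //.
by rewrite futaki_lt ?mul1n ?muln_gt0 ?q_gt0 ?dim_piece_gt0.
Qed.

(** Multiplying by [f] in [A_1 = B_1^(l)] raises the degree by 1 and the index by [l], so the index
    stays strictly above slope [l]; [A_socle] provides an [f] with nonzero product. *)
Lemma lift_tc_propagate i k : (i <= q)%N -> i%:Z * l < k -> lift_tc i k != 0%VS ->
  lift_tc q (q%:Z * l + 1) != 0%VS.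
Proof.
move=> iq; have [d qE] : exists d, q = (i + d)%N by exists (q - i)%N; rewrite subnKC.
elim: d i k iq qE => [|d IH] i k iq qE ilk nz.
  rewrite addn0 in qE; subst i; move: nz; rewrite -!subv0; apply: contra.
  by apply: subv_trans; apply: lift_tc_mono; lia.
apply: (IH i.+1 (k + l)); [by lia | by lia | by lia |].
have /A_socle[f xf] : vpick (lift_tc i k) != 0 by rewrite vpick0.
apply: contra_neq xf => B0; apply/eqP; rewrite -memv0 -B0.
by apply: lift_tc_mul; rewrite ?memv_pick ?B1_full ?memvf //; lia.
Qed.

Lemma tc_futaki_lt_flat : lift_tc 1 (l + 1) = 0%VS -> ~ tc_trivial B ->
  (tc_futaki B 1 < tc_futaki B q)%E.
Proof.
move=> B1_0 nontriv; have lift0 i (U : {vspace truncation A q i}) :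
    lift_img U = 0%VS -> U = 0%VS.
  by move=> U0; apply/eqP; rewrite -dimv_eq0 -dim_lift_img U0 dimv0.
have Bq : lift_tc q (q%:Z * l + 1) != 0%VS.
  apply/eqP => Bq0; apply: nontriv; exists l => i k.
  have [iq|qi] := leqP i q; last by split=> _; exact: truncation_gt.
  split=> [|ilk]; first exact: tc_full.
  apply: lift0; apply/eqP; apply: contraT => nz.
  by have := lift_tc_propagate iq ilk nz; rewrite Bq0 eqxx.
have [M1 w1] := tc_weight_shift q_gt0.
have [Mq wq] := tc_weight_shift (leqnn q).
(* The successor makes the sum in degree [q] start with the positive term
   [\dim (lift_tc q (q * l + 1))]. *)
apply: tc_futaki_lt; rewrite (w1 M1) // (wq Mq.+1) //.
rewrite [X in _ + X]big1 => [|j _]; last first.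
  apply/eqP; rewrite eqz_nat dimv_eq0 -subv0 -B1_0 mul1r; apply: lift_tc_mono; lia.
have D1 := dim_piece_gt0 1; rewrite mul1r addr0 big_ord_recl /=.
rewrite -dimv_eq0 -lt0n in Bq.
set s := \sum_(j < Mq) _; have s0 : 0 <= s by apply: sumr_ge0.
rewrite PoszM !mulrDl.
have -> : l * (\dim {: A 1%N})%:Z * (q%:Z * (\dim {: A q})%:Z) =
  q%:Z * l * (\dim {: A q})%:Z * (\dim {: A 1%N})%:Z by ring.
rewrite ltrDl; apply: ltr_wpDr; first by rewrite mulr_ge0.
by rewrite mulr_gt0.
Qed.

Section Filtration.
Variables (r : nat) (V : filtration (A 1%N) r).
Hypothesis VE : forall k : nat, V k = lift_tc 1 (l + k%:Z).

(** Each linear factor of weight [a] lies in [B_1^(l + a)], so a word of length [n] collects [n * l]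
    plus its weight. *)
Lemma adm_ideal_lift_tc k n : (n <= q)%N ->
  (adm_ideal V k n <= lift_tc n (n%:Z * l + k%:Z))%VS.
Proof.
elim: n k => [|n IH] k nq.
  case: k => [|k]; last by rewrite adm_ideal_gt ?sub0v.
  by rewrite addr0 lift_tc_full // subvf.
apply: adm_ideal_sub => a k' v x kak' Vv Ix.
have Bx := subvP (IH k' (ltnW nq)) _ Ix; rewrite VE in Vv.
have := lift_tc_mul (add1n n) nq Vv Bx; apply: subvP; apply: lift_tc_mono.
have -> : n.+1%:Z * l = l + n%:Z * l by rewrite -add1n PoszD mulrDl mul1r.
by lia.
Qed.

Lemma lift_tc_adm_ideal1 (k : nat) : (lift_tc 1 (l + k%:Z) <= adm_ideal V k 1)%VS.
Proof. by rewrite -VE; exact: filt_adm_ideal1. Qed.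

Lemma tc_futaki_lt_filt : (filt_futaki V 1 < filt_futaki V q)%E ->
  (tc_futaki B 1 < tc_futaki B q)%E.
Proof.
rewrite futaki_lt ?mul1n ?muln_gt0 ?q_gt0 ?dim_piece_gt0 // => ltV.
have [M1 w1] := tc_weight_shift q_gt0.
have [Mq wq] := tc_weight_shift (leqnn q).
(* A common length for all four weight sums; the ideals in degrees up to [q] vanish beyond
   [q * r]. *)
pose m := (M1 + Mq + q * r)%N.
have V0 n k : (n <= q)%N -> (m < k)%N -> adm_ideal V k n = 0%VS.
  move=> nq mk; apply: adm_ideal_gt; apply: leq_ltn_trans mk.
  by rewrite (leq_trans (leq_mul nq (leqnn r))) // leq_addl.
apply: tc_futaki_lt; rewrite (w1 m) ?(wq m) /m; try by lia.
rewrite (filt_weightE (V0 1%N ^~ q_gt0)) (filt_weightE (V0 q ^~ (leqnn q))) in ltV.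
move: ltV; set s1 := \sum_(j < m) _; set sq := \sum_(j < m) _.
rewrite -/m; set t1 := \sum_(j < m) _; set tq := \sum_(j < m) _ => ltV.
have ts1 : t1 <= s1.
  apply: ler_sum => j _; rewrite lez_nat; apply: dimvS; rewrite mul1r.
  exact: lift_tc_adm_ideal1.
have tsq : sq <= tq.
  by apply: ler_sum => j _; rewrite lez_nat; apply: dimvS; exact: adm_ideal_lift_tc.
rewrite PoszM !mulrDl mul1r.
(* After clearing denominators the two contributions of the slope [l] agree and cancel. *)
have -> : l * (\dim {: A 1%N})%:Z * (q%:Z * (\dim {: A q})%:Z) =
  q%:Z * l * (\dim {: A q})%:Z * (\dim {: A 1%N})%:Z by ring.
rewrite ltrD2l -PoszM; apply: le_lt_trans (lt_le_trans ltV _).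
  by rewrite ler_wpM2r.
by rewrite ler_wpM2r.
Qed.

End Filtration.

(** The length [r] is the last index where the shifted family is nonzero, found as the least [n]
    with zero at [n + 1]. *)
Lemma lift_tc_filtration :
  lift_tc 1 (l + 1) != fullv -> lift_tc 1 (l + 1) != 0%VS ->
  exists r (V : filtration (A 1%N) r), forall k : nat, V k = lift_tc 1 (l + k%:Z).
Proof.
move=> B1_proper nz; have [M BM] := fin_generated_vanish (tc_fg B 1).
pose P n := lift_tc 1 (l + n.+1%:Z) == 0%VS.
have exP : exists n, P n.
  by exists `|M%:Z - l|%N; rewrite /P /lift_tc BM ?/lift_img ?limg0 //; lia.
case: (ex_minnP exP) => r Pr min.
have Vr : lift_tc 1 (l + r%:Z) != 0%VS.
  (* Minimality says nothing at [r = 0], where the space is [A_1], nonzero by [dim_piece_gt0]. *)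
  case: r {Pr} min => [|r] min; last first.
    by apply: contraT; rewrite negbK => /min; rewrite ltnn.
  by rewrite addr0 B1_full -dimv_eq0 -lt0n dim_piece_gt0.
have r0 : (0 < r)%N by rewrite lt0n; apply: contraNneq nz => r0; move: Pr; rewrite r0.
have V0 : lift_tc 1 (l + 0%N%:Z) = fullv by rewrite addr0.
have Vdec (k : nat) : (lift_tc 1 (l + k.+1%:Z) <= lift_tc 1 (l + k%:Z))%VS.
  by apply: lift_tc_mono; lia.
have Vgt (k : nat) : (r < k)%N -> lift_tc 1 (l + k%:Z) = 0%VS.
  move=> rk; apply/eqP; rewrite -subv0 -(eqP Pr); apply: lift_tc_mono; lia.
by exists r, (@Filtration K (A 1%N) r (fun k => lift_tc 1 (l + k%:Z))
  r0 V0 B1_proper Vdec Vr Vgt).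
Qed.

End Configuration.

Lemma hilbert_stable_iff : hilbert_stable A <-> stable A.
Proof.
split=> [[N hN]|[N [N0 hN]]].
  exists N.+1; split=> // q Nq q1 B nontriv; have q0 := ltnW q1.
  have [l [B1 B1']] := lift_tc_jump B q0.
  have [B0|Bnz] := eqVneq (lift_tc B 1 (l + 1)) 0%VS.
    exact: tc_futaki_lt_flat B0 nontriv.
  have [r [V VE]] := lift_tc_filtration q0 B1 B1' Bnz.
  apply: (tc_futaki_lt_filt q0 B1 VE); apply: hN; exact: ltnW.
(* This bound also ensures [q > 1], as [q_stable] is only given there. *)
exists N.+2 => q Nq r V; have q1 : (1 < q)%N by exact: leq_trans Nq.
have q0 := ltnW q1; rewrite -!(filt_tc_futaki A_gen V (q := q)) //.
by apply: hN => //; [lia | exact: filt_tc_nontrivial].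
Qed.

End HilbertStability.

(* (Y, O_Y(1)) = (Proj S, O(1)) *)
Theorem proposition3p24 (K : fieldType) (charK : [pchar K] =i pred0)
    (S : comAlgType K) (G : standard_grading S)
    (Y_nonempty : [set: Proj G] !=set0)
    (Y_connected : connected [set: Proj G])
    (H_vanish : forall i, (0 < i)%N -> cohomology_vanishes (OProj G 1) i)
    (A : graded_algebra K) (A_coord : homogeneous_coordinate_ring G A) :
  hilbert_stable A <-> stable A.
Proof.
have [phi phiP] := A_coord.
apply: hilbert_stable_iff; first exact: coordinate_ring_generated phiP.
exact: coordinate_ring_socle_free phiP.
Qed.
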